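(* Let $u\in X$ be the unique solution of $\mathsf{F}(u)=0$ in $X'$. For any initial value $u^0=u_h^0\in X_h$, let $\{u^n\}_{n\ge 0}\subset X$ and $\{u_h^n\}_{n\ge 0}\subset X_h$ be defined by \[ (u^{n+1},v)_X=\mathsf{B}(u^n)(v)\quad \forall v\in X,\qquad (u_h^{n+1},v_h)_X=\mathsf{B}(u_h^n)(v_h)\quad \forall v_h\in X_h, \] and assume that, with a constant $\eta_h\ge 0$, \[ \left|\mathsf{B}(u_h^n)(v)-(u_h^{n+1},v)_X\right|\le \eta_h\|v\|_X\qquad \forall v\in X,\ \forall n\ge 0 . \] Then, for all $n\ge 0$, \[ \|u-u_h^n\|_X\le \frac{1}{1-\alpha}\left(\alpha^n\|u^1-u^0\|_X+\eta_h\right). \]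
   Context: $X$ is a real Hilbert space with inner product $(\cdot,\cdot)_X$ and norm $\|\cdot\|_X$, $X'$ is its dual, and $X_h\subset X$ is a finite dimensional linear subspace. $\mathsf{F}:X\to X'$ is a possibly nonlinear operator such that, for constants $L>0$, $c>0$ and all $x,y,v\in X$, \[ |\mathsf{F}(x)(v)-\mathsf{F}(y)(v)|\le L\|x-y\|_X\|v\|_X,\qquad (\mathsf{F}(x)-\mathsf{F}(y))(x-y)\ge c\|x-y\|_X^2 . \] Under these assumptions $\mathsf{F}(u)=0$ has a unique solution $u\in X$. For $t=c/L^2$ the operator $\mathsf{B}$ is defined by $\mathsf{B}(u)(v):=(u,v)_X-t\,\mathsf{F}(u)(v)$ for $u,v\in X$, and $\alpha:=\sqrt{1-(c/L)^2}$, which is assumed to lie in $(0,1)$. *)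

(* Defs.v *)
From HB Require Import structures.
From mathcomp Require Import all_boot all_order all_algebra.
From mathcomp Require Import all_classical all_reals all_analysis.

Set Implicit Arguments.
Unset Strict Implicit.
Unset Printing Implicit Defensive.

Import Order.TTheory GRing.Theory Num.Theory.
Import numFieldNormedType.Exports.

Local Open Scope classical_set_scope.
Local Open Scope ring_scope.

Definition continuous_linear (R : realType) (X : normedModType R) :
    {pred X -> R^o} :=
  fun f => `[< linear f /\ continuous f >].

Lemma continuous_linear_submod (R : realType) (X : normedModType R) :
  submod_closed (@continuous_linear R X).
Proof.
split.
  apply/asboolP; split; last by move=> x; exact: cvg_cst.
  by move=> a x y; rewrite /= scaler0 addr0.
move=> a f g /asboolP[lf cf] /asboolP[lg cg]; apply/asboolP; split.
  move=> b x y; rewrite !fctE lf lg !scalerDr !scalerA [a * b]mulrC.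
  by rewrite addrACA.
by move=> x; apply: cvgD; [apply: cvgZl_tmp; exact: cf | exact: cg].
Qed.

HB.instance Definition _ (R : realType) (X : normedModType R) :=
  GRing.isSubmodClosed.Build R (X -> R^o) (@continuous_linear R X)
    (@continuous_linear_submod R X).

(* The topological dual X', with the pointwise operations inherited from
   X -> R^o; thus [F u = 0] for [F : X -> dual X] is an equation in X'. *)
Record dual (R : realType) (X : normedModType R) := Dual {
  dual_fun :> X -> R^o;
  dualP : dual_fun \in @continuous_linear R X }.

HB.instance Definition _ (R : realType) (X : normedModType R) :=
  [isSub for @dual_fun R X].
HB.instance Definition _ (R : realType) (X : normedModType R) :=
  [Choice of dual X by <:].
HB.instance Definition _ (R : realType) (X : normedModType R) :=
  [SubChoice_isSubLmodule of dual X by <:].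

Definition finite_dimensional (R : realType) (X : normedModType R)
    (V : submodClosed X) :=
  exists (n : nat) (e : 'I_n -> X), (forall i, e i \in V) /\
    forall x, x \in V -> exists a : 'I_n -> R, x = \sum_(i < n) a i *: e i.

(* The step t = c / L^2 minimizes 1 - 2 t c + t^2 L^2, the bound on the squared
   Lipschitz constant of x |-> x - t F(x) (Riesz representative); its value
   there is 1 - (c / L)^2, the square of [contraction_factor]. *)
Definition step_size (R : realType) (L c : R) : R := c / L ^+ 2.

Definition contraction_factor (R : realType) (L c : R) : R :=
  Num.sqrt (1 - (c / L) ^+ 2).

(* [{dot X for idfun}] is the type of symmetric bilinear positive definite forms
   on X; that [ip] induces the norm of X is a separate hypothesis where needed. *)
Definition opB (R : realType) (X : normedModType R)
    (ip : {dot X for idfun}) (F : X -> dual X) (t : R) (x v : X) : R :=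
  ip x v - t * F x v.

(* Main.v *)
Require Import Defs.
From mathcomp Require Import all_boot all_order all_algebra.
From mathcomp Require Import all_classical all_reals all_analysis.
From mathcomp Require Import ring lra.

Set Implicit Arguments.
Unset Strict Implicit.
Unset Printing Implicit Defensive.

Import Order.TTheory GRing.Theory Num.Theory.
Import numFieldNormedType.Exports.

Local Open Scope ring_scope.

(** The operator [B] is a contraction with constant [alpha]: the step
    [t = c / L^2] is chosen so that [1 - 2 t c + t^2 L^2 = alpha^2], and
    monotonicity and Lipschitz continuity of [F] combine to
    [|B x v - B y v| <= alpha |x - y| |v|] ([ler_opB_sub]).  Classically one
    expands the squared norm of the Riesz representative of [B x - B y].  Here
    the representative is replaced by a single test vector lying in the span of
    [x - y] and [v] ([sqr_damped_functional_le]), so the Riesz theorem does not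
    enter.

    The solution [u] is a fixed point: [B u v = (u, v)].  Hence if [y] matches
    [B x] up to a residual [eta], then [|u - y| <= alpha |u - x| + eta]
    ([perturbed_step]).  With [eta = eta_h] this gives a recursive inequality
    for the errors of the discrete iterates, whose solution is
    [alpha^n |u - u^0| + eta_h / (1 - alpha)] ([affine_recursion_le]); with
    [eta = 0] and the triangle inequality it gives the a posteriori bound
    [(1 - alpha) |u - u^0| <= |u^1 - u^0|]. *)

(** * The norm of an inner product *)

Section InnerProduct.
Variables (R : realType) (X : normedModType R) (ip : {dot X for idfun}).
Hypothesis ip_norm : forall x : X, `|x| = Num.sqrt (ip x x).

Lemma dot_self_norm (x : X) : ip x x = `|x| ^+ 2.
Proof.
rewrite ip_norm sqr_sqrtr //.
have [->|x0] := eqVneq x 0; first by rewrite linear0l.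
exact/ltW/neq0_dnorm_gt0.
Qed.

Lemma dot_sym (x y : X) : ip x y = ip y x.
Proof. by rewrite hermC /= expr0 mul1r. Qed.

Lemma sqr_norm_lincomb (a b : R) (x y : X) :
  `|a *: x - b *: y| ^+ 2 =
    a ^+ 2 * `|x| ^+ 2 - 2 * a * b * ip x y + b ^+ 2 * `|y| ^+ 2.
Proof.
rewrite -!dot_self_norm linearBl !linearBr !linearZl_LR !linearZr_LR /=.
by rewrite (dot_sym y x) /GRing.scale /=; ring.
Qed.

(** Testing with [x] itself recovers the norm: the dual characterisation. *)
Lemma norm_le_of_dot (x : X) (K : R) :
  0 <= K -> (forall v, ip x v <= K * `|v|) -> `|x| <= K.
Proof.
move=> K0 /(_ x); rewrite dot_self_norm expr2.
have [->|x0] := eqVneq x 0; first by rewrite normr0.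
by rewrite ler_pM2r // normr_gt0.
Qed.

(** * Contraction of the damped iteration *)

(** The left-hand side is the square of the number [psi := (d, v) - t phi v].
    Evaluating [phi] at [z := |v|^2 d - psi v] makes [2 |v|^2 t phi z] contain
    [2 |v|^2 psi^2], whereas the bound [M |z|] on [phi z] and the inequality of
    arithmetic and geometric means allow only half as much; the mixed terms
    [psi (d, v)] cancel exactly.  The choice of [z]: if [r] represents
    [(d, .) - t phi], then [psi v / |v|^2] is the projection of [r] on the line
    of [v], so that [z / |v|^2] stands for [d - r], the representative of
    [t phi]. *)
Lemma sqr_damped_functional_le (phi : X -> R) (t M : R) (d v : X) :
    linear (phi : X -> R^o) -> 0 <= t ->
    (forall w, `|phi w| <= M * `|w|) ->
  (ip d v - t * phi v) ^+ 2 <=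
    (`|d| ^+ 2 - 2 * t * phi d + t ^+ 2 * M ^+ 2) * `|v| ^+ 2.
Proof.
move=> phi_lin t0 phi_le; set psi := ip d v - t * phi v.
have phi_lincomb (a b : R) (x y : X) :
    phi (a *: x - b *: y) = a * phi x - b * phi y.
  have phiZ e w : phi (e *: w) = e * phi w.
    have phi0 : phi 0 = 0.
      by have := phi_lin (- 1) 0 0; rewrite scaler0 addr0 scaleN1r addNr.
    by have := phi_lin e w 0; rewrite addr0 phi0 addr0.
  by rewrite -scaleNr (phi_lin a x) phiZ mulNr.
have [v0|v_neq0] := eqVneq v 0.
  have phi0 : phi 0 = 0.
    by have := phi_lincomb 0 0 0 0; rewrite !scale0r !mul0r !subr0.
  by rewrite /psi v0 phi0 linear0r normr0 mulr0 subr0 !expr0n /= mulr0.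
have V_gt0 : 0 < `|v| ^+ 2 by rewrite exprn_gt0 // normr_gt0.
pose z := `|v| ^+ 2 *: d - psi *: v.
have phi_z : t * phi z <= t * (M * `|z|).
  by rewrite ler_wpM2l // (le_trans (ler_norm _)).
have z_sqr : `|z| ^+ 2 = (`|v| ^+ 2) ^+ 2 * `|d| ^+ 2
    - 2 * `|v| ^+ 2 * psi * ip d v + psi ^+ 2 * `|v| ^+ 2.
  exact: sqr_norm_lincomb.
have t_phi_v : t * phi v = ip d v - psi by rewrite /psi; ring.
have t_phi_z : t * phi z = `|v| ^+ 2 * (t * phi d) - psi * (ip d v - psi).
  by rewrite phi_lincomb -t_phi_v; ring.
have amgm := sqr_ge0 (t * M * `|v| ^+ 2 - `|z|).
have {}phi_z : 2 * `|v| ^+ 2 * (t * phi z) <= 2 * `|v| ^+ 2 * (t * (M * `|z|)).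
  by rewrite ler_pM2l // mulr_gt0.
rewrite -(ler_pM2l V_gt0) -subr_ge0.
rewrite t_phi_z in phi_z.
move: phi_z amgm z_sqr; clear; set V := `|v| ^+ 2; set Z := `|z|.
set D := `|d| ^+ 2; set p := ip d v; set f := phi d; clearbody V Z D p f psi.
nra.
Qed.

End InnerProduct.

Lemma dual_linear (R : realType) (X : normedModType R) (f : dual X) :
  linear (f : X -> R^o).
Proof. by have /asboolP[] := dualP f. Qed.

Lemma dual_subE (R : realType) (X : normedModType R) (f g : dual X) (v : X) :
  (f - g) v = f v - g v.
Proof. by rewrite -[dual_fun _]/(\val (f - g)) raddfB. Qed.

Section Contraction.
Variables (R : realType) (X : normedModType R) (ip : {dot X for idfun}).
Hypothesis ip_norm : forall x : X, `|x| = Num.sqrt (ip x x).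
Variables (F : X -> dual X) (L c : R).
Hypotheses (L_gt0 : 0 < L) (c_gt0 : 0 < c).
Hypothesis F_lip : forall x y v : X, `|F x v - F y v| <= L * `|x - y| * `|v|.
Hypothesis F_mono :
  forall x y : X, c * `|x - y| ^+ 2 <= (F x - F y) (x - y).

Let B := opB ip F (step_size L c).
Let alpha := contraction_factor L c.
Hypothesis alpha_gt0 : 0 < alpha.

Lemma sqr_contraction_factor :
  alpha ^+ 2 = 1 - 2 * step_size L c * c + step_size L c ^+ 2 * L ^+ 2.
Proof.
rewrite sqr_sqrtr; last by move: alpha_gt0; rewrite sqrtr_gt0 => /ltW.
by rewrite /step_size; field; rewrite gt_eqF.
Qed.

Lemma ler_opB_sub (x y v : X) : `|B x v - B y v| <= alpha * `|x - y| * `|v|.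
Proof.
have t_ge0 : 0 <= step_size L c by rewrite divr_ge0 ?exprn_ge0 // ltW.
have -> : B x v - B y v = ip (x - y) v - step_size L c * (F x - F y) v.
  by rewrite /B /opB dual_subE linearBl; ring.
rewrite -(@ler_pXn2r _ 2) ?nnegrE ?mulr_ge0 // ?(ltW alpha_gt0) //.
rewrite real_normK ?num_real //.
have F_bnd w : `|(F x - F y) w| <= L * `|x - y| * `|w|.
  by rewrite dual_subE.
apply: le_trans (sqr_damped_functional_le ip_norm (x - y) v
  (@dual_linear _ _ (F x - F y)) t_ge0 F_bnd) _.
rewrite [leRHS]exprMn ler_wpM2r ?sqr_ge0 // [leRHS]exprMn.
rewrite sqr_contraction_factor.
have := ler_wpM2l t_ge0 (F_mono x y); nra.
Qed.

(** Since [B u v = (u, v)], the residual of [u - y] splits into [B u - B x],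
    which contracts, and [B x - (y, .)], which is at most [eta]. *)
Lemma perturbed_step (u x y : X) (eta : R) :
    F u = 0 -> 0 <= eta ->
    (forall v, `|B x v - ip y v| <= eta * `|v|) ->
  `|u - y| <= alpha * `|u - x| + eta.
Proof.
move=> Fu0 eta_ge0 res; apply: (norm_le_of_dot ip_norm).
  by rewrite addr_ge0 // mulr_ge0 // ltW.
move=> v; have Bu : B u v = ip u v by rewrite /B /opB Fu0 mulr0 subr0.
have -> : ip (u - y) v = (B u v - B x v) + (B x v - ip y v).
  by rewrite Bu linearBl; ring.
rewrite mulrDl; apply: lerD; apply: le_trans (ler_norm _) _ => //.
exact: ler_opB_sub.
Qed.

End Contraction.

(** * Error bound *)

(** The constant [eta / (1 - a)] is the fixed point of [s |-> a s + eta]. *)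
Lemma affine_recursion_le (R : realFieldType) (a eta : R) (e : nat -> R) :
    0 <= a < 1 -> 0 <= eta -> (forall n, e n.+1 <= a * e n + eta) ->
  forall n, e n <= a ^+ n * e 0%N + (1 - a)^-1 * eta.
Proof.
move=> /andP[a_ge0 a_lt1] eta_ge0 step; elim=> [|n IHn].
  by rewrite expr0 mul1r lerDl mulr_ge0 // invr_ge0 subr_ge0 ltW.
apply: le_trans (step n) _.
have -> : a ^+ n.+1 * e 0%N + (1 - a)^-1 * eta =
    a * (a ^+ n * e 0%N + (1 - a)^-1 * eta) + eta.
  by rewrite exprS; field; rewrite subr_eq0 gt_eqF.
by rewrite lerD2r ler_wpM2l.
Qed.

Theorem corollary2p2 (R : realType) (X : completeNormedModType R)
    (ip : {dot X for idfun})
    (ip_norm : forall x : X, `|x| = Num.sqrt (ip x x))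
    (Xh : submodClosed X) (Xh_fin : finite_dimensional Xh)
    (F : X -> dual X) (L c : R) (L_gt0 : 0 < L) (c_gt0 : 0 < c)
    (F_lip : forall x y v : X, `|F x v - F y v| <= L * `|x - y| * `|v|)
    (F_mono : forall x y : X, c * `|x - y| ^+ 2 <= (F x - F y) (x - y)) :
  let B := opB ip F (step_size L c) in
  let alpha := contraction_factor L c in
  0 < alpha < 1 ->
  forall (u : X), F u = 0 ->
  forall (un uhn : nat -> X) (eta : R),
    un 0%N = uhn 0%N ->
    (forall n, uhn n \in Xh) ->
    (forall n (v : X), ip (un n.+1) v = B (un n) v) ->
    (forall n (v : X), v \in Xh -> ip (uhn n.+1) v = B (uhn n) v) ->
    0 <= eta ->
    (forall n (v : X), `|B (uhn n) v - ip (uhn n.+1) v| <= eta * `|v|) ->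
  forall n, `|u - uhn n| <=
    (1 - alpha)^-1 * (alpha ^+ n * `|un 1%N - un 0%N| + eta).
Proof.
move=> B alpha /andP[alpha_gt0 alpha_lt1] u Fu0 un uhn eta un0 _ un_step _.
move=> eta_ge0 res n.
have step := perturbed_step ip_norm L_gt0 c_gt0 F_lip F_mono alpha_gt0 Fu0.
have initial : `|u - un 0%N| <= (1 - alpha)^-1 * `|un 1%N - un 0%N|.
  have exact_step : `|u - un 1%N| <= alpha * `|u - un 0%N| + 0.
    apply: step => // v.
    by rewrite un_step subrr normr0 mul0r.
  rewrite mulrC ler_pdivlMr ?subr_gt0 //.
  have := ler_distD (un 1%N) u (un 0%N); lra.
have rec k : `|u - uhn k.+1| <= alpha * `|u - uhn k| + eta by exact: step.
have alpha01 : 0 <= alpha < 1 by rewrite ltW.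
apply: le_trans (affine_recursion_le (e := fun k => `|u - uhn k|) alpha01
  eta_ge0 rec n) _.
rewrite -un0 mulrDr lerD2r mulrCA.
by rewrite ler_wpM2l // exprn_ge0 // ltW.
Qed.
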